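(* For a positive integer $n$, let $D_n$ denote the $n$-th derangement number, i.e. the number of permutations $\sigma$ of $\{1,\ldots,n\}$ with $\sigma(i)\neq i$ for all $i\in\{1,\ldots,n\}$; equivalently $D_n=\sum_{k=0}^n(-1)^k\frac{n!}{k!}$. Then the sequence $\left(\sqrt[n+1]{D_{n+1}}/\sqrt[n]{D_n}\right)_{n\geq 3}$ is strictly decreasing and converges to $1$. *)

(* Defs.v *)
From mathcomp Require Import all_boot all_order all_algebra all_fingroup.
From mathcomp Require Import all_classical all_reals all_analysis.
Set Implicit Arguments.
Unset Strict Implicit.
Unset Printing Implicit Defensive.
Import Order.TTheory GRing.Theory Num.Theory.
Import numFieldNormedType.Exports.
Local Open Scope ring_scope.

Definition derangement_number (n : nat) : nat :=
  #|[set s : 'S_n | [forall i, s i != i]]%SET|.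

(* Real n-th root of a nonnegative x; for x = 0 < n it is 0, because
   0 `^ y = 0 whenever y != 0. *)
Definition nth_root (R : realType) (n : nat) (x : R) : R := x `^ n%:R^-1.

(* Only meaningful for n >= 2: the denominator vanishes at n = 1, and 0-th
   roots are junk. *)
Definition derangement_root_ratio (R : realType) (n : nat) : R :=
  nth_root n.+1 (derangement_number n.+1)%:R /
  nth_root n (derangement_number n)%:R.

(* Main.v *)
(** Put L n = ln D_n, so that the n-th term is exp (L(n+1)/(n+1) - L(n)/n).
    Inclusion-exclusion over the sets of fixed points gives
    D_(n+1) = (n+1) D_n + (-1)^(n+1).

    Strict monotonicity says that L(n)/n is strictly concave. After clearing
    denominators, the concavity defect increases with n as soon as the third
    difference of L is negative, i.e. D_(n+1)^3 D_(n+3) < D_(n+2)^3 D_n; by the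
    recurrence this is a polynomial inequality in D_(n+1), true as soon as
    D_(n+1) is larger than a quadratic in n. Three numerical cases start
    the induction.

    For the limit, 0 <= L(n) <= n ln (n+1) and 0 <= L(n+1) - L(n) <= ln (n+2)
    bound the exponent by ln (n+2) / (n+1) <= 2 / sqrt (n+1). *)
Require Import Defs.
From mathcomp Require Import all_boot all_order all_algebra all_fingroup.
From mathcomp Require Import all_classical all_reals all_analysis.
From mathcomp Require Import ring lra zify.
Import Order.TTheory GRing.Theory Num.Theory.
Import numFieldNormedType.Exports.
Local Open Scope classical_set_scope.
Local Open Scope ring_scope.

(** * Inclusion-exclusion and the recurrence *)

(** The indicator of having no fixed point is the product over [i] of [1 - [s i = i]]. Expanding it
    over subsets [A], exchanging the sums and grouping by [#|A|] leaves a count of the permutations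
    that fix [A] pointwise. *)
Lemma natr_card_derangements (R : comNzRingType) (T : finType) :
  #|[set s : {perm T} | [forall i, s i != i]]%SET|%:R =
  \sum_(k < #|T|.+1) (-1) ^+ k *+ ('C(#|T|, k) * (#|T| - k)`!) :> R.
Proof.
pose fixes (A : {set T}) (s : {perm T}) := [forall i in A, s i == i].
have card_fixes (A : {set T}) : #|[pred s | fixes A s]| = (#|T| - #|A|)`!.
  (* Fixing [A] pointwise means moving only points of the complement of [A]. *)
  rewrite -[in RHS](finset.setCK A) -cardsCs -(card_perm (~: A)%SET); apply: eq_card => s.
  rewrite !inE; apply/forallP/fintype.subsetP => [sA i | sA i].
    by rewrite !inE => si; apply: contra si => iA; have := sA i; rewrite iA.
  apply/implyP => iA; apply/negPn/negP => si.
  by have := sA i si; rewrite inE iA.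
have derangement_indicator (s : {perm T}) :
    ([forall i, s i != i])%:R =
    \sum_(A : {set T} | fixes A s) (-1) ^+ #|A| :> R.
  transitivity (\prod_(i : T) (- (s i == i)%:R + 1) : R).
    have [/forallP sD|/forallPn[i /negPn/eqP si]] := boolP [forall i, s i != i].
      by rewrite big1 // => i _; rewrite (negbTE (sD i)) oppr0 add0r.
    by rewrite (bigD1 i) //= si eqxx addNr mul0r.
  rewrite bigA_distr [RHS]big_mkcond /=; apply: eq_bigr => A _.
  rewrite -big_mkcond /=.
  have [/forall_inP sA|/forall_inPn[i iA /negbTE si]] := boolP (fixes A s).
    rewrite -prodr_const; apply: eq_bigr => i iA.
    by rewrite sA.
  by rewrite (bigD1 i) //= si oppr0 mul0r.
have -> : #|[set s : {perm T} | [forall i, s i != i]]%SET|%:R =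
    \sum_(s : {perm T}) ([forall i, s i != i])%:R :> R.
  rewrite -natr_sum -big_mkcond sum1dep_card; congr (_%:R).
under eq_bigr => s _ do rewrite derangement_indicator big_mkcond.
rewrite exchange_big /=.
under eq_bigr => A _ do rewrite -big_mkcond sumr_const card_fixes.
rewrite (partition_big (fun A : {set T} => inord #|A| : 'I_#|T|.+1) xpredT) //=.
apply: eq_bigr => k _.
have eqk (A : {set T}) : (inord #|A| == k) = (#|A| == k).
  by rewrite -val_eqE /= inordK // ltnS max_card.
under eq_bigl => A do rewrite eqk.
under eq_bigr => A /eqP -> do [].
by rewrite sumr_const -mulrnA mulnC -card_draws cardsE.
Qed.

Lemma natr_derangement_number (R : comNzRingType) (n : nat) :
  (derangement_number n)%:R =
  \sum_(k < n.+1) (-1) ^+ k *+ ('C(n, k) * (n - k)`!) :> R.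
Proof. by have := natr_card_derangements R 'I_n; rewrite !card_ord. Qed.

(** Since ['C(n, k) * (n - k)! = n! / k!], each term with [k <= n] is multiplied by [n + 1]; the new
    term [k = n + 1] is the sign. *)
Lemma natr_derangement_numberS (R : comNzRingType) (n : nat) :
  (derangement_number n.+1)%:R =
  n.+1%:R * (derangement_number n)%:R + (-1) ^+ n.+1 :> R.
Proof.
rewrite !natr_derangement_number big_ord_recr /= binn subnn mul1n mulr1n.
congr (_ + _); rewrite mulr_sumr; apply: eq_bigr => -[k /= kn] _.
rewrite mulr_natl -mulrnA; congr (_ *+ _); rewrite ltnS in kn.
have bin_factW m : (k <= m)%N -> ('C(m, k) * (m - k)`! * k`! = m`!)%N.
  by move=> km; rewrite -mulnA [(_`! * _)%N]mulnC bin_fact.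
apply/eqP; rewrite -(eqn_pmul2r (fact_gt0 k)) bin_factW 1?ltnW //.
by rewrite mulnAC bin_factW // factS mulnC.
Qed.

(** * Lower bounds on derangement numbers *)

Lemma natr_derangement_number_recl (R : realDomainType) (n : nat) :
  n.+1%:R * (derangement_number n)%:R - 1 <= (derangement_number n.+1)%:R :> R.
Proof.
rewrite natr_derangement_numberS lerD2l -signr_odd.
by case: (odd _); rewrite ?expr1 ?expr0; lra.
Qed.

Lemma derangement_number_ge1 (R : realDomainType) (n : nat) :
  1 <= (derangement_number n.+2)%:R :> R.
Proof.
elim: n => [|n IHn].
  rewrite !natr_derangement_numberS natr_derangement_number big_ord1.
  by rewrite bin0 subn0 fact0 expr0 expr1; lra.
apply: le_trans (natr_derangement_number_recl R n.+2).
have n0 : 0 <= n%:R :> R by [].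
by rewrite -(natr1 n.+2) -(natr1 n.+1) -(natr1 n); nra.
Qed.

(** This is the quadratic required by [quartic_lt]. The bound fails at 5, where 44 < 49. *)
Lemma derangement_number_ge_quadratic (R : realDomainType) (n : nat) :
  (6 <= n)%N ->
  (n%:R + 1) * (n%:R + 3) + 1 <= (derangement_number n)%:R :> R.
Proof.
move=> /subnK <-; elim: (n - 6)%N => [|{}n IHn].
  rewrite !natr_derangement_numberS natr_derangement_number big_ord1.
  by rewrite bin0 subn0 fact0 expr0; lra.
apply: le_trans (natr_derangement_number_recl R (n + 6)).
have n0 : 0 <= n%:R :> R by [].
rewrite addSn -(natr1 (n + 6)) natrD in IHn *.
by nra.
Qed.

(** * Negativity of the third difference *)

(** Here [a], [b], [c], [d] are four consecutive derangement numbers. Multiplying by [x] eliminates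
    [a], as [x * a = b - s], and the difference becomes [c * K - s * x * b ^+ 3]. The quadratic
    bound on [b] gives [b ^+ 2 <= K], and [x * b < c] then makes [c * K] exceed [x * b ^+ 3]. *)
Lemma quartic_lt (R : realFieldType) (x s a b c d : R) :
  s = 1 \/ s = -1 -> 0 < x -> (x + 1) * (x + 3) + 1 <= b ->
  b = x * a + s -> c = (x + 1) * b - s -> d = (x + 2) * c + s ->
  b ^+ 3 * d < c ^+ 3 * a.
Proof.
move=> s1 x0 hb eb ec ed; rewrite -subr_gt0 -(pmulr_rgt0 _ x0).
have ss : s * s = 1 by case: s1 => ->; lra.
have b1 : 1 < b by nra.
pose K := b ^+ 3 - s * ((x + 1) * (x + 3)) * b ^+ 2 + (2 * x + 3) * b - s.
have -> : x * (c ^+ 3 * a - b ^+ 3 * d) = c * K - s * (x * b ^+ 3).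
  have xa : x * a = b - s by rewrite eb; ring.
  transitivity (c ^+ 3 * (x * a) - x * b ^+ 3 * d); first by ring.
  rewrite xa ed /K.
  transitivity (c * ((x + 1) ^+ 2 * b ^+ 2 - 2 * s * (x + 1) * b + s * s) * (b - s)
     - x * b ^+ 3 * ((x + 2) * c + s)); first by rewrite ec; ring.
  rewrite ss.
  transitivity (c * (b ^+ 3 - s * ((x + 1) * (x + 3)) * b ^+ 2 + (s * s * 2 * (x + 1) + 1) * b - s) - s * (x * b ^+ 3)); first by ring.
  by rewrite ss; ring.
have c0 : x * b < c by case: s1 => e; rewrite ec e; lra.
have bb : 0 < b ^+ 2 by rewrite exprn_gt0 //; lra.
have xb : 0 < x * b by rewrite mulr_gt0 //; lra.
have Kge : b ^+ 2 <= K.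
  rewrite /K; have -> : b ^+ 3 = b * b ^+ 2 by ring.
  have : ((x + 1) * (x + 3) + 1) * b ^+ 2 <= b * b ^+ 2 by rewrite ler_wpM2r // ltW.
  have : 0 <= (x + 1) * (x + 3) * b ^+ 2 by rewrite !mulr_ge0 //; lra.
  by case: s1 => ->; lra.
have : c * b ^+ 2 <= c * K by rewrite ler_wpM2l //; lra.
have : x * b * b ^+ 2 < c * b ^+ 2 by rewrite ltr_pM2r.
have -> : b ^+ 3 = b * b ^+ 2 by ring.
have : 0 < x * b * b ^+ 2 by rewrite mulr_gt0.
by case: s1 => ->; rewrite mulrA; lra.
Qed.

Definition ln_derangement (R : realType) (n : nat) : R :=
  ln (derangement_number n)%:R.

Lemma ln_derangement_third_difference (R : realType) (n : nat) : (5 <= n)%N ->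
  3 * ln_derangement R n.+1 + ln_derangement R n.+3 <
  3 * ln_derangement R n.+2 + ln_derangement R n.
Proof.
move=> n5.
have D0 k : (5 <= k)%N -> 0 < (derangement_number k)%:R :> R.
  by case: k => [|[|k]] // _; apply: lt_le_trans (derangement_number_ge1 R k).
have [D1 D2 D3 D4] :
  [/\ 0 < (derangement_number n)%:R :> R, 0 < (derangement_number n.+1)%:R :> R,
      0 < (derangement_number n.+2)%:R :> R & 0 < (derangement_number n.+3)%:R :> R].
  by split; apply: D0; lia.
rewrite /ln_derangement !mulr_natl -!lnXn // -!lnM ?posrE ?exprn_gt0 //.
rewrite ltr_ln ?posrE ?mulr_gt0 ?exprn_gt0 //.
apply: (@quartic_lt R n.+1%:R ((-1) ^+ n.+1)).
- by rewrite -signr_odd; case: (odd _); [right | left]; rewrite ?expr1.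
- by rewrite ltr0n.
- by apply: derangement_number_ge_quadratic; lia.
- exact: natr_derangement_numberS.
- by rewrite natr_derangement_numberS natr1 !exprS; ring.
- by rewrite natr_derangement_numberS -natrD addn2 !exprS; ring.
Qed.

(** * Concavity of [ln D_n / n] *)

(** Reduces the numerical base cases to comparisons of integers. *)
Lemma lt_lnX (R : realType) (p q r k l m : nat) :
  (0 < p)%N -> (0 < q)%N -> (0 < r)%N -> (p ^ k * r ^ m < q ^ l)%N ->
  k%:R * ln p%:R + m%:R * ln r%:R < l%:R * ln q%:R :> R.
Proof.
move=> p0 q0 r0 lt_pq; rewrite !mulr_natl -!lnXn ?ltr0n //.
rewrite -lnM ?posrE ?exprn_gt0 ?ltr0n // ltr_ln ?posrE ?mulr_gt0 ?exprn_gt0 ?ltr0n //.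
by rewrite -!natrX -natrM ltr_nat.
Qed.

Lemma derangement_number_small :
  [/\ derangement_number 3 = 2, derangement_number 4 = 9,
      derangement_number 5 = 44, derangement_number 6 = 265
    & derangement_number 7 = 1854]%N.
Proof.
(* The recurrence involves a sign, so the values are computed in [int]. *)
have Z k m : (derangement_number k)%:R = m%:R :> int -> derangement_number k = m.
  by move/eqP; rewrite eqr_nat => /eqP.
by split; apply: Z; rewrite !natr_derangement_numberS natr_derangement_number
  big_ord1 bin0 subn0 fact0.
Qed.

(* Strict concavity of [ln D_n / n], with denominators cleared. The defect
   grows with [n] by [(n + 1) (n + 2)] times the negated third difference of
   [ln D], so the bound propagates from [n = 5]. *)
Lemma ln_derangement_concave (R : realType) (n : nat) : (3 <= n)%N ->
  (n%:R + 1) * (n%:R + 2) * ln_derangement R n +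
  n%:R * (n%:R + 1) * ln_derangement R n.+2 <
  2 * n%:R * (n%:R + 2) * ln_derangement R n.+1.
Proof.
have [d3 d4 d5 d6 d7] := derangement_number_small.
case: n => [|[|[|[|[|n] ] ] ] ] // _.
(* The coefficients in the three numerical cases are those of the statement, halved. *)
- have : 10%:R * ln 2%:R + 6%:R * ln 44%:R < 15%:R * ln 9%:R :> R.
    by apply: lt_lnX; lia.
  by rewrite /ln_derangement d3 d4 d5; lra.
- have : 15%:R * ln 9%:R + 10%:R * ln 265%:R < 24%:R * ln 44%:R :> R.
    by apply: lt_lnX; lia.
  by rewrite /ln_derangement d4 d5 d6; lra.
elim: n => [|n IHn].
  have : 21%:R * ln 44%:R + 15%:R * ln 1854%:R < 35%:R * ln 265%:R :> R.
    by apply: lt_lnX; lia.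
  by rewrite /ln_derangement d5 d6 d7; lra.
have := ln_derangement_third_difference R _ (isT : (5 <= n.+4.+1)%N).
rewrite -subr_gt0 -(natr1 n.+4.+1) => lt3; rewrite -subr_gt0 in IHn *.
have x0 : 0 < (n.+4.+1%:R + 1) * (n.+4.+1%:R + 2) :> R by rewrite mulr_gt0 ?addr_gt0 ?ltr0n.
have := addr_gt0 IHn (mulr_gt0 x0 lt3).
by set x := n.+4.+1%:R; lra.
Qed.

(** * Bounds on the exponent and the limit *)

Lemma ln_derangement_ge0 (R : realType) (n : nat) : 0 <= ln_derangement R n.+2.
Proof. by rewrite ln_ge0 ?derangement_number_ge1. Qed.

(** The recurrence has factor [n + 3]; raising it to [n + 4] adds one more [D_(n+2) >= 1], which
    absorbs the sign. *)
Lemma ln_derangementS_le (R : realType) (n : nat) :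
  ln_derangement R n.+3 <= ln_derangement R n.+2 + ln n.+4%:R.
Proof.
have D1 := derangement_number_ge1 R n; have D2 := derangement_number_ge1 R n.+1.
have D0 : 0 < (derangement_number n.+2)%:R :> R by lra.
have n0 : 0 < n.+4%:R :> R by rewrite ltr0n.
rewrite /ln_derangement -lnM // ler_ln ?posrE ?mulr_gt0 //; last by lra.
rewrite natr_derangement_numberS -(natr1 n.+3) mulrDr mulr1 mulrC lerD2l.
by apply: le_trans D1; rewrite -signr_odd; case: (odd _); rewrite ?expr1 ?expr0; lra.
Qed.

Lemma ln_derangementS_ge (R : realType) (n : nat) :
  ln_derangement R n.+2 <= ln_derangement R n.+3.
Proof.
have D1 := derangement_number_ge1 R n; have D2 := derangement_number_ge1 R n.+1.
rewrite /ln_derangement ler_ln ?posrE; try lra.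
apply: le_trans (natr_derangement_number_recl R n.+2).
have n0 : 0 <= n%:R :> R by [].
by rewrite -(natr1 n.+2) -(natr1 n.+1) -(natr1 n); nra.
Qed.

Lemma ln_derangement_le (R : realType) (n : nat) :
  ln_derangement R n.+2 <= n.+2%:R * ln n.+3%:R.
Proof.
elim: n => [|n IHn].
  rewrite /ln_derangement !natr_derangement_numberS natr_derangement_number big_ord1.
  rewrite bin0 subn0 fact0 expr0 expr1 [X in ln X <= _](_ : _ = 1); last by lra.
  by rewrite ln1 mulr_ge0 ?ln_ge0 ?ler1n.
apply: le_trans (ln_derangementS_le R n) _.
rewrite -(natr1 n.+2) mulrDl mul1r lerD2r; apply: le_trans IHn _.
by rewrite ler_wpM2l // ler_ln ?posrE ?ltr0n // ler_nat.
Qed.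

Lemma derangement_root_ratioE (R : realType) (n : nat) :
  derangement_root_ratio R n.+2 =
  expR (ln_derangement R n.+3 / n.+3%:R - ln_derangement R n.+2 / n.+2%:R).
Proof.
have D0 k : 0 < (derangement_number k.+2)%:R :> R.
  exact: lt_le_trans (derangement_number_ge1 R k).
(* Positivity selects the exponential branch of [powR]. *)
by rewrite /derangement_root_ratio /nth_root /powR !gt_eqF // -expRN -expRD
  ![_^-1 * _]mulrC.
Qed.

(** Follows from [x + 1 <= (1 + sqrt x) ^+ 2] and [ln (1 + y) <= y]. *)
Lemma ln_le_sqrt (R : realType) (x : R) : 0 < x -> ln (x + 1) <= 2 * Num.sqrt x.
Proof.
move=> x0; have s0 : 0 <= Num.sqrt x := sqrtr_ge0 x.
have sx : x = Num.sqrt x ^+ 2 by rewrite sqr_sqrtr // ltW.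
have : ln (x + 1) <= ln ((1 + Num.sqrt x) ^+ 2).
  by rewrite ler_ln ?posrE ?exprn_gt0 //; lra.
rewrite lnXn; last by lra.
have : ln (1 + Num.sqrt x) <= Num.sqrt x by rewrite le_ln1Dx //; lra.
lra.
Qed.

Lemma ln_derangement_root_ratio_bound (R : realType) (n : nat) :
  `|ln_derangement R n.+3 / n.+3%:R - ln_derangement R n.+2 / n.+2%:R| <=
  2 * Num.sqrt (n.+3%:R^-1).
Proof.
have x0 : 0 < n.+2%:R :> R by rewrite ltr0n.
have y0 : 0 < n.+3%:R :> R by rewrite ltr0n.
(* Both the increment of [ln D] and [ln D_(n+2) / (n+2)] lie between 0 and [ln (n+4)], hence so does
   the absolute value of their difference. *)
have -> : ln_derangement R n.+3 / n.+3%:R - ln_derangement R n.+2 / n.+2%:R =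
    (ln_derangement R n.+3 - ln_derangement R n.+2) / n.+3%:R -
    ln_derangement R n.+2 / n.+2%:R / n.+3%:R.
  have n0 : 0 <= n%:R :> R by [].
  by field; rewrite !gt_eqF //; lra.
have le_lnsqrt : ln n.+4%:R / n.+3%:R <= 2 * Num.sqrt (n.+3%:R^-1) :> R.
  rewrite ler_pdivrMr //; apply: (@le_trans _ _ (2 * Num.sqrt n.+3%:R)).
    by rewrite -(natr1 n.+3) ln_le_sqrt.
  rewrite (sqrtrV (ltW y0)) -mulrA ler_pM2l //.
  rewrite [leRHS](_ : _ = Num.sqrt n.+3%:R) //.
  have s0 : Num.sqrt n.+3%:R != 0 :> R by rewrite gt_eqF // sqrtr_gt0.
  by rewrite -[X in _ * X](sqr_sqrtr (ltW y0)) expr2 mulKf.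
apply: le_trans le_lnsqrt.
have y0' : 0 < n.+3%:R^-1 :> R by rewrite invr_gt0.
rewrite -mulrBl normrM (gtr0_norm y0') ler_pM2r // ler_norml.
have h1 : 0 <= ln_derangement R n.+2 / n.+2%:R.
  by rewrite divr_ge0 ?ln_derangement_ge0 // ltW.
have h2 : ln_derangement R n.+2 / n.+2%:R <= ln n.+4%:R.
  rewrite ler_pdivrMr // mulrC; apply: le_trans (ln_derangement_le R n) _.
  by rewrite ler_pM2l // ler_ln ?posrE ?ltr0n // ler_nat.
have := ln_derangementS_le R n; have := ln_derangementS_ge R n.
move: h1 h2; move: (ln_derangement R n.+2 / _) => q h1 h2 h3 h4.
by apply/andP; split; lra.
Qed.

Theorem theorem1p2 (R : realType) :
  decreasing_seq (fun n : nat => derangement_root_ratio R (n + 3)) /\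
  ((fun n : nat => derangement_root_ratio R (n + 3)) @ \oo --> (1 : R)).
Proof.
split.
  apply/decreasing_seqP => n; rewrite !addn3 !derangement_root_ratioE ltr_expR.
  have := ln_derangement_concave R n.+3 isT.
  have x0 : 0 < n.+3%:R :> R by rewrite ltr0n.
  rewrite -(natr1 n.+4) -(natr1 n.+3).
  move: (n.+3%:R) (ln_derangement R n.+3) (ln_derangement R n.+4)
    (ln_derangement R n.+4.+1) x0 => x u v w x0 h.
  rewrite -subr_gt0.
  rewrite [X in 0 < X](_ : _ = (2 * x * (x + 2) * v -
      ((x + 1) * (x + 2) * u + x * (x + 1) * w)) / (x * (x + 1) * (x + 2))).
    by rewrite divr_gt0 ?subr_gt0 // !mulr_gt0 //; lra.
  by field; rewrite !gt_eqF //; lra.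
rewrite -expR0.
under eq_fun => n do rewrite addn3 derangement_root_ratioE.
apply: continuous_cvg; first exact: continuous_expR.
have bound0 : (fun n => 2 * Num.sqrt (n.+4%:R^-1)) @ \oo --> (0 : R).
  rewrite -[0](mulr0 2) -[in X in _ --> X]sqrtr0; apply: cvgMr.
  apply: continuous_cvg; first exact: sqrt_continuous.
  (* The inverse of [n.+4] is the harmonic sequence shifted by 3. *)
  by have := @cvg_harmonic R; rewrite -(cvg_shiftn 3); under eq_fun do rewrite addn3.
apply/norm_cvg0P; apply: squeeze_cvgr (cvg_cst _) bound0.
by apply: nearW => n; rewrite normr_ge0 ln_derangement_root_ratio_bound.
Qed.
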